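(* Suppose there is a constant $\delta\ge 0$ such that $W_p(\mathbb{P}_i,\mathbb{P}_j)\le\delta$ for all $i,j\in[n]$, and assume that for all $x\in\mathcal{X}$ the function $\xi\mapsto\ell(x,\xi)$ is $L_\xi$-Lipschitz on $\Xi$. Let $p\ge1$, and for each $i\in[n]$ let $N_i\ge1$, $\beta_i\in(0,1)$ and $\varepsilon_i:=\varepsilon_i^{N_i}(\beta_i)$, where $\varepsilon_i^{N_i}(\cdot)$ is the radius function defined in the context. Let $\widehat{x}^\star$ be an optimizer and $\widehat{J}^\star$ the optimal value of $$\inf_{x\in\mathcal{X}}\ \sup_{\mathbb{Q}\in\mathcal{W}_{\mathrm G}}\mathbb{E}_{\mathbb{Q}}[\ell(x,\xi)],$$ and let $J:=\mathbb{E}_{\mathbb{P}}[\ell(\widehat{x}^\star,\xi)]$ be the true expected cost at $\widehat{x}^\star$. Then, with probability (over the joint sampling of the client datasets) at least $\prod_{i=1}^n(1-\beta_i)$, $$\widehat{J}^\star-L_\xi(2r+\delta)\ \le\ J\ \le\ \widehat{J}^\star,\qquad r:=\max_{i\in[n]}\varepsilon_i.$$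
   Context: Let $[n]=\{1,\dots,n\}$, let $\Xi\subseteq\mathbb{R}^m$ and $\mathcal{X}\subseteq\mathbb{R}^d$ be convex and compact, and let $p\in[1,\infty)$. The cost function $\ell:\mathbb{R}^d\times\Xi\to\mathbb{R}$ is continuous on $\mathcal{X}\times\Xi$. $\mathcal{M}(\Xi)$ is the set of probability distributions supported on $\Xi$ (with finite $p$-th moment). $W_p$ is the $p$-Wasserstein distance for the Euclidean metric: $W_p(\mathbb{Q},\mathbb{Q}')=\big(\inf_{\gamma\in\Gamma(\mathbb{Q},\mathbb{Q}')}\int\|x-y\|^p\,d\gamma(x,y)\big)^{1/p}$, where $\Gamma(\mathbb{Q},\mathbb{Q}')$ is the set of couplings. Lipschitz continuity is with respect to the Euclidean norm. Each client $i\in[n]$ has an (unknown) distribution $\mathbb{P}_i\in\mathcal{M}(\Xi)$. Its dataset $\mathcal{D}_i=\{\widehat\xi_i^1,\dots,\widehat\xi_i^{N_i}\}$ consists of $N_i$ i.i.d. samples from $\mathbb{P}_i$, and the datasets $\mathcal{D}_1,\dots,\mathcal{D}_n$ are mutually independent. The empirical distribution is $\widehat{\mathbb{P}}_i=\frac1{N_i}\sum_{k=1}^{N_i}\delta_{\widehat\xi_i^k}$. The true group distribution is $\mathbb{P}=\sum_{i=1}^n\alpha_i^\star\mathbb{P}_i$ for some unknown $\alpha^\star\in\Delta_{n-1}:=\{\alpha\in\mathbb{R}^n:\alpha_i\ge0,\ \sum_i\alpha_i=1\}$. Local ambiguity sets: $\mathcal{W}_i(\varepsilon_i)=\{\mathbb{Q}\in\mathcal{M}(\Xi):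 W_p(\mathbb{Q},\widehat{\mathbb{P}}_i)\le\varepsilon_i\}$. Global ambiguity set: $\mathcal{W}_{\mathrm G}=\{\sum_{i=1}^n\alpha_i\mathbb{Q}_i:\ \alpha\in\Delta_{n-1},\ \mathbb{Q}_i\in\mathcal{W}_i(\varepsilon_i)\ \forall i\}$. Radius function: with $R:=\frac12\mathrm{diam}_\infty(\Xi)$ (half the diameter of $\Xi$ in the infinity norm) and $h(x):=x^2/(\ln(2+1/x))^2$ for $x>0$, define for $\beta\in(0,1)$ $$\varepsilon_i^{N_i}(\beta):=\begin{cases}R\Big[h^{-1}\Big(\frac{\ln(c_1\beta^{-1})}{c_2N_i}\Big)\Big]^{1/p},& p=m/2,\\ R\Big(\frac{\ln(c_1\beta^{-1})}{c_2N_i}\Big)^{1/\max\{2p,m\}},& p\ne m/2.\end{cases}$$ Here $c_1,c_2$ are constants depending only on $p$ and $m$, namely the constants of the known measure-concentration result (which may be taken as given): these radii are well defined for all $\beta\in(0,1)$, and for every client $i$, every $N_i\ge1$ and every $\beta\in(0,1)$, $\Pr\{W_p(\mathbb{P}_i,\widehat{\mathbb{P}}_i)\le\varepsilon_i^{N_i}(\beta)\}\ge1-\beta$. *)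

(* Defs.v *)
From HB Require Import structures.
From mathcomp Require Export all_boot all_order all_algebra.
From mathcomp Require Export all_classical all_reals all_analysis.

Set Implicit Arguments.
Unset Strict Implicit.
Unset Printing Implicit Defensive.

Import Order.TTheory GRing.Theory Num.Theory.
Import numFieldNormedType.Exports.

Local Open Scope classical_set_scope.
Local Open Scope ring_scope.

(* R^m, as row vectors, with its Borel sigma-algebra. *)
Notation borel_rV R m := (g_sigma_algebraType (@open 'rV[R]_m)).

(* The library norm `|x| on 'rV[R]_m is the max-norm. *)
Definition eucl_norm (R : realType) (m : nat) (x : 'rV[R]_m) : R :=
  Num.sqrt (\sum_(j < m) (x ord0 j) ^+ 2).

Definition eucl_dist (R : realType) (m : nat) (x y : 'rV[R]_m) : R :=
  eucl_norm (x - y).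

Definition eucl_lipschitz_on (R : realType) (m : nat) (A : set 'rV[R]_m)
    (L : R) (f : 'rV[R]_m -> R) : Prop :=
  0 <= L /\
  forall x y, A x -> A y -> `|f x - f y| <= L * eucl_dist x y.

Definition diam_infty (R : realType) (m : nat) (A : set 'rV[R]_m) : R :=
  sup [set `|x - y| | x in A & y in A].

Definition simplex (R : realType) (n : nat) (a : 'I_n -> R) : Prop :=
  (forall i, 0 <= a i) /\ \sum_(i < n) a i = 1.

(* M(Xi); p is the order of the moment, which is automatically finite when Xi
   is compact. *)
Definition prob_on (R : realType) (m : nat) (p : R) (Xi : set 'rV[R]_m)
    (Q : probability (borel_rV R m) R) : Prop :=
  Q Xi = 1%E /\ (\int[Q]_x (eucl_norm x `^ p)%:E < +oo)%E.

(* Marginals, mixtures and empirical laws are compared on measurable sets only,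
   since the value of a measure on a non-measurable set is unspecified. *)
Definition coupling (R : realType) (m : nat)
    (Q Q' : set (borel_rV R m) -> \bar R)
    (g : probability (borel_rV R m * borel_rV R m)%type R) : Prop :=
  forall A : set (borel_rV R m), measurable A ->
    g (A `*` setT) = Q A /\ g (setT `*` A) = Q' A.

Definition wasserstein (R : realType) (m : nat) (p : R)
    (Q Q' : set (borel_rV R m) -> \bar R) : \bar R :=
  ((ereal_inf
      [set \int[g]_z (eucl_dist z.1 z.2 `^ p)%:E | g in coupling Q Q'])
    `^ p^-1)%E.

Definition is_mixture (R : realType) (m n : nat) (a : 'I_n -> R)
    (Q : 'I_n -> probability (borel_rV R m) R)
    (S : probability (borel_rV R m) R) : Prop :=
  forall A : set (borel_rV R m), measurable A ->
    S A = (\sum_(i < n) (a i)%:E * Q i A)%E.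

Definition empirical (R : realType) (m N : nat) (x : 'I_N -> 'rV[R]_m)
    (A : set (borel_rV R m)) : \bar R :=
  ((N%:R^-1)%:E * \sum_(k < N) \d_(x k : borel_rV R m) A)%E.

Definition local_ball (R : realType) (m N : nat) (p : R) (Xi : set 'rV[R]_m)
    (x : 'I_N -> 'rV[R]_m) (eps : R) : set (probability (borel_rV R m) R) :=
  [set Q | prob_on p Xi Q /\ (wasserstein p Q (empirical x) <= eps%:E)%E].

Definition global_ball (R : realType) (m n : nat) (N : 'I_n -> nat) (p : R)
    (Xi : set 'rV[R]_m) (x : forall i : 'I_n, 'I_(N i) -> 'rV[R]_m)
    (eps : 'I_n -> R) : set (probability (borel_rV R m) R) :=
  [set S | exists (a : 'I_n -> R) (Q : 'I_n -> probability (borel_rV R m) R),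
    [/\ simplex a,
        forall i, local_ball p Xi (x i) (eps i) (Q i)
      & is_mixture a Q S]].

(* The integral is restricted to Xi, because the cost is only given on Xi. *)
Definition expected_cost (R : realType) (d m : nat) (Xi : set 'rV[R]_m)
    (ell : 'rV[R]_d -> 'rV[R]_m -> R) (Q : probability (borel_rV R m) R)
    (x : 'rV[R]_d) : \bar R :=
  (\int[Q]_(xi in Xi) (ell x xi)%:E)%E.

Definition worst_case_cost (R : realType) (d m : nat) (Xi : set 'rV[R]_m)
    (ell : 'rV[R]_d -> 'rV[R]_m -> R)
    (W : set (probability (borel_rV R m) R)) (x : 'rV[R]_d) : \bar R :=
  ereal_sup [set expected_cost Xi ell Q x | Q in W].

Definition optimal_value (R : realType) (d m : nat) (X : set 'rV[R]_d)
    (Xi : set 'rV[R]_m) (ell : 'rV[R]_d -> 'rV[R]_m -> R)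
    (W : set (probability (borel_rV R m) R)) : \bar R :=
  ereal_inf [set worst_case_cost Xi ell W x | x in X].

Definition is_optimizer (R : realType) (d m : nat) (X : set 'rV[R]_d)
    (Xi : set 'rV[R]_m) (ell : 'rV[R]_d -> 'rV[R]_m -> R)
    (W : set (probability (borel_rV R m) R)) (x : 'rV[R]_d) : Prop :=
  X x /\ worst_case_cost Xi ell W x = optimal_value X Xi ell W.

(* Mutual independence of a finite family of classes of events. *)
Definition independent_classes (R : realType) (d : measure_display)
    (Omega : measurableType d) (Pr : probability Omega R) (I : finType)
    (F : I -> set (set Omega)) : Prop :=
  forall (J : {set I}) (E : I -> set Omega),
    (forall i, i \in J -> F i (E i)) ->
    Pr (\bigcap_(i in [set` J]) E i) = (\prod_(i in J) Pr (E i))%E.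

Definition sigma_of (R : realType) (d : measure_display)
    (Omega : measurableType d) (m : nat) (X : Omega -> borel_rV R m) :
    set (set Omega) :=
  preimage_set_system setT X measurable.

Definition sigma_of_sample (R : realType) (d : measure_display)
    (Omega : measurableType d) (m N : nat)
    (X : 'I_N -> Omega -> borel_rV R m) : set (set Omega) :=
  <<s \bigcup_k sigma_of (X k) >>.

Definition iid_sample (R : realType) (d : measure_display)
    (Omega : measurableType d) (Pr : probability Omega R) (m N : nat)
    (Q : probability (borel_rV R m) R)
    (X : 'I_N -> {RV Pr >-> borel_rV R m}) : Prop :=
  (forall k (A : set (borel_rV R m)), measurable A ->
     distribution Pr (X k) A = Q A) /\
  independent_classes Pr (fun k => sigma_of (X k)).

(* "A holds with probability at least q", witnessed by an event of the class F;
   for a set A in a sigma-algebra F it means q <= Pr A. *)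
Definition prob_at_least (R : realType) (d : measure_display)
    (Omega : measurableType d) (Pr : probability Omega R)
    (F : set (set Omega)) (A : set Omega) (q : R) : Prop :=
  exists E : set Omega, [/\ F E, E `<=` A & (q%:E <= Pr E)%E].

Definition h_fun (R : realType) (x : R) : R :=
  x ^+ 2 / (ln (2 + x^-1)) ^+ 2.

(* h_fun is an increasing bijection of ]0, +oo[; the default 0 is only used
   outside the range y > 0. *)
Definition h_inv (R : realType) (y : R) : R :=
  xget 0 [set x | 0 < x /\ h_fun x = y].

Definition radius_arg (R : realType) (c1 c2 : R) (N : nat) (beta : R) : R :=
  ln (c1 * beta^-1) / (c2 * N%:R).

Definition conc_radius (R : realType) (m : nat) (p : R) (Xi : set 'rV[R]_m)
    (c1 c2 : R) (N : nat) (beta : R) : R :=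
  let r := diam_infty Xi / 2 in
  let y := radius_arg c1 c2 N beta in
  if p == m%:R / 2 then r * h_inv y `^ p^-1
  else r * y `^ (Num.max (2 * p) m%:R)^-1.

(* The arguments of the logarithm, of h^-1 and of the powers in the radius lie
   in their domains; the library's ln and `^ are total functions. *)
Definition radius_well_defined (R : realType) (c1 c2 : R) : Prop :=
  forall (N : nat) (beta : R), (0 < N)%N -> 0 < beta < 1 ->
    0 < c1 * beta^-1 /\ 0 < radius_arg c1 c2 N beta.

(* The event is only required to contain an event of the sigma-algebra of the
   sample that is likely enough. *)
Definition concentration (R : realType) (m : nat) (p : R)
    (Xi : set 'rV[R]_m) (c1 c2 : R) (Q : probability (borel_rV R m) R) : Prop :=
  forall (d : measure_display) (Omega : measurableType d)
    (Pr : probability Omega R) (N : nat)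
    (X : 'I_N -> {RV Pr >-> borel_rV R m}) (beta : R),
    (0 < N)%N -> 0 < beta < 1 -> iid_sample Q X ->
    prob_at_least Pr (sigma_of_sample X)
      [set w | (wasserstein p Q (empirical (fun k => X k w))
                <= (conc_radius p Xi c1 c2 N beta)%:E)%E]
      (1 - beta).

(* Main.v *)
(* Samples lie in Xi almost surely, so by independence, with probability at
   least the product of the 1 - beta i, every client has all its samples in Xi
   and satisfies W_p(P i, empirical i) <= eps i. On that event every P i lies in
   its ball, hence Ptrue lies in the global ball and J <= Jhat. Conversely, for
   Q i in the i-th ball, the easy half of Kantorovich duality applied three
   times (Q i to the empirical law, to P i, to P j) bounds the expected cost under Q i
   by that under P j plus L (2 eps i + delta); the bound passes to mixtures.
   Each step uses a near-optimal coupling, under which the mean distance is at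
   most the p-th root of the mean p-th power by Hoelder, so neither the triangle
   inequality for W_p nor the gluing of couplings is needed. *)
Require Import Defs.
From HB Require Import structures.
From mathcomp Require Import all_boot all_order all_algebra.
From mathcomp Require Import all_classical all_reals all_analysis.
From mathcomp Require Import measurable_realfun.

Set Implicit Arguments.
Unset Strict Implicit.
Unset Printing Implicit Defensive.

Import Order.TTheory GRing.Theory Num.Theory.
Import numFieldNormedType.Exports.

Local Open Scope classical_set_scope.
Local Open Scope ring_scope.

(** * Borel measurability on ['rV[R]_m] and on pairs of vectors *)

Lemma open_measurable_rV (R : realType) (m : nat) (A : set (borel_rV R m)) :
  open (A : set 'rV[R]_m) -> measurable A.
Proof. exact: sub_sigma_algebra. Qed.

Lemma closed_measurable_rV (R : realType) (m : nat) (A : set (borel_rV R m)) :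
  closed (A : set 'rV[R]_m) -> measurable A.
Proof.
by move=> cA; rewrite -[A]setCK; apply: measurableC; apply: open_measurable_rV;
  exact: closed_openC.
Qed.

Lemma compact_measurable_rV (R : realType) (m : nat) (A : set (borel_rV R m)) :
  compact (A : set 'rV[R]_m) -> measurable A.
Proof.
move=> cA; apply: closed_measurable_rV; apply: compact_closed cA.
exact: norm_hausdorff.
Qed.

(** Open intervals generate the Borel sets of the line, and continuity within [D] makes the preimage
    of such an interval the trace on [D] of an open set. *)
Lemma within_continuous_measurable_rV (R : realType) (m : nat)
    (D : set 'rV[R]_m) (f : 'rV[R]_m -> R) :
  measurable (D : set (borel_rV R m)) -> {within D, continuous f} ->
  measurable_fun (D : set (borel_rV R m)) f.
Proof.
move=> mD /continuousP cf; apply: (measurability _ (RGenOpens.measurableE R)).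
move=> _ [_ [a [b ->] <-]].
have oab : open (`]a, b[%classic : set R) by exact: interval_open.
have /open_subspaceP[U oU UD] := cf _ oab.
rewrite setIC -UD; apply: measurableI => //; exact: open_measurable_rV.
Qed.

Lemma measurable_coord (R : realType) (m : nat) (j : 'I_m) :
  measurable_fun setT (fun x : borel_rV R m => (x : 'rV[R]_m) ord0 j).
Proof.
apply: within_continuous_measurable_rV; first exact: measurableT.
apply: continuous_subspaceT => x; exact: coord_continuous.
Qed.

(** The argument is coordinatewise because pairs carry the product of two Borel sigma-algebras,
    which is not by definition the Borel sigma-algebra of the product topology. *)
Lemma measurable_eucl_dist (R : realType) (m : nat) :
  measurable_fun setT
    (fun z : borel_rV R m * borel_rV R m => eucl_dist z.1 z.2).
Proof.
apply: (@measurableT_comp _ _ _ _ _ _ (@Num.sqrt R)).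
  apply: continuous_measurable_fun; exact: sqrt_continuous.
apply: measurable_sum => j; apply: measurable_funX.
rewrite (_ : (fun _ => _) = (fun z : borel_rV R m * borel_rV R m =>
   (z.1 : 'rV[R]_m) ord0 j - (z.2 : 'rV[R]_m) ord0 j)); last first.
  by apply/funext => z; rewrite !mxE.
apply: measurable_funB.
  exact: (measurableT_comp (measurable_coord j) measurable_fst).
exact: (measurableT_comp (measurable_coord j) measurable_snd).
Qed.

(** * Couplings: near-optimal choice and comparison of integrals *)

Lemma probability_setI_full (d : measure_display) (T : measurableType d)
    (R : realType) (P : probability T R) (A B : set T) :
  measurable A -> measurable B -> P B = 1%E -> P (A `&` B) = P A.
Proof.
move=> mA mB PB.
have PCB : P (~` B) = 0%E by rewrite probability_setC// PB subee.
apply/eqP; rewrite eq_le measureIl//=.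
rewrite -{1}(setIT A) -(setUv B) setIUr.
apply: le_trans (measureU2 _ _ _) _; [exact: measurableI|exact: measurableD|].
rewrite -[leRHS]adde0 leeD2l// -PCB; apply: measureIr => //; exact: measurableC.
Qed.

(** Both cylinders over [Xi] have mass 1 by the marginal conditions, hence so does their
    intersection. This lets Lipschitz bounds known only on [Xi] be integrated against [g]. *)
Lemma coupling_ae (R : realType) (m : nat) (Xi : set 'rV[R]_m)
    (Q Q' : set (borel_rV R m) -> \bar R)
    (g : probability (borel_rV R m * borel_rV R m)%type R) :
  measurable (Xi : set (borel_rV R m)) ->
  coupling Q Q' g -> Q Xi = 1%E -> Q' Xi = 1%E ->
  {ae g, forall z, Xi z.1 /\ Xi z.2}.
Proof.
move=> mXi gQ QXi Q'Xi; have [g1 g2] := gQ _ mXi.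
have mXi1 : measurable ((Xi : set (borel_rV R m)) `*` [set: borel_rV R m]).
  exact: measurableX.
have mXi2 : measurable ([set: borel_rV R m] `*` (Xi : set (borel_rV R m))).
  exact: measurableX.
exists (~` ((Xi `*` setT) `&` (setT `*` Xi))); split.
- by apply: measurableC; exact: measurableI.
- rewrite [LHS]probability_setC; last exact: measurableI.
  by rewrite probability_setI_full// ?g2 // g1 QXi subee.
- by apply: subsetC => z /= [[? _] [_ ?]].
Qed.

(** Hoelder's inequality against the constant 1, whose norm is 1 for every exponent because [g] has
    total mass 1. *)
Lemma expectation_le_powR (d : measure_display) (T : measurableType d)
    (R : realType) (g : probability T R) (f : T -> R) (p : R) :
  1 <= p -> measurable_fun setT f -> (forall x, 0 <= f x) ->
  (\int[g]_x (f x)%:E <= (\int[g]_x (f x `^ p)%:E) `^ p^-1)%E.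
Proof.
move=> p1 mf f0.
have Np r : ('N[g]_r%:E[EFin \o f] = (\int[g]_x (f x `^ r)%:E) `^ r^-1)%E.
  rewrite unlock; congr (_ `^ _)%E; apply: eq_integral => x _ /=.
  by rewrite ger0_norm.
have N1 : ('N[g]_1[EFin \o f] = \int[g]_x (f x)%:E)%E.
  by rewrite Lnorm1; apply: eq_integral => x _ /=; rewrite ger0_norm.
(* For [p = 1] the conjugate exponent would be infinite; both sides then coincide. *)
have [->|pN1] := eqVneq p 1; first by rewrite -Np N1.
have p_gt1 : 1 < p by rewrite lt_neqAle eq_sym pN1.
have p0 : 0 < p by exact: lt_trans p_gt1.
have q0 : 0 < 1 - p^-1 by rewrite subr_gt0 invf_lt1.
have := @hoelder _ _ _ g f (cst 1) p (1 - p^-1)^-1 mf (measurable_cst _) p0.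
rewrite invr_gt0 invrK subrKC => /(_ q0 erefl).
have -> : ('N[g]_((1 - p^-1)^-1)%:E[EFin \o cst 1%R] = 1)%E.
  apply: etrans (Lnorm_cst1 _ _) _; rewrite -(poweR1r (1 - p^-1)^-1^-1).
  by congr (_ `^ _)%E; exact: probability_setT.
rewrite mule1 Np.
rewrite (_ : EFin \o _ = EFin \o f) ?N1//.
by apply/funext => x /=; rewrite mulr1.
Qed.

(** The strict inequality leaves room below [c], so no coupling attaining the infimum is
    required. *)
Lemma wasserstein_coupling (R : realType) (m : nat) (p c : R)
    (Q Q' : set (borel_rV R m) -> \bar R) :
  1 <= p -> (wasserstein p Q Q' < c%:E)%E ->
  exists2 g, coupling Q Q' g & (\int[g]_z (eucl_dist z.1 z.2)%:E <= c%:E)%E.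
Proof.
move=> p1 Wc.
have p0 : 0 < p by exact: lt_le_trans p1.
have c0 : 0 <= c by rewrite -lee_fin (le_trans (poweR_ge0 _ _) (ltW Wc)).
have pK (x : \bar R) : (0 <= x)%E -> ((x `^ p) `^ p^-1 = x)%E.
  by move=> x0; rewrite -poweRrM mulfV ?gt_eqF// poweRe1.
have mon (x y : \bar R) :
    (0 <= x)%E -> (x <= y)%E -> (x `^ p^-1 <= y `^ p^-1)%E.
  move=> x0 xy; apply: gt0_ler_poweR => //; rewrite ?invr_ge0 1?ltW//.
    by rewrite in_itv/= x0 leey.
  by rewrite in_itv/= (le_trans x0 xy) leey.
have cp0 : (0 <= c%:E `^ p)%E by exact: poweR_ge0.
move: Wc; rewrite /wasserstein; set S := (X in ereal_inf X) => Wc.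
(* Otherwise taking [p]-th roots, a monotone operation, would put the distance at or above [c]. *)
have /ereal_inf_lt[_ [g gQ <-] gc] : (ereal_inf S < c%:E `^ p)%E.
  rewrite ltNge; apply/negP => /(mon _ _ cp0).
  by rewrite pK ?lee_fin// leNgt Wc.
exists g => //.
have d0 (z : borel_rV R m * borel_rV R m) : 0 <= eucl_dist z.1 z.2.
  exact: sqrtr_ge0.
apply: le_trans (expectation_le_powR g p1 (@measurable_eucl_dist R m) d0) _.
rewrite -[leRHS]pK ?lee_fin//; apply: mon; last exact: ltW.
by apply: integral_ge0 => z _; rewrite lee_fin powR_ge0.
Qed.

(** On measurable sets each marginal is the pushforward of [g] along a projection, so this is a
    change of variables. Nonnegativity of [F] replaces integrability. *)
Lemma coupling_integral (R : realType) (m : nat)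
    (Q Q' : probability (borel_rV R m) R)
    (g : probability (borel_rV R m * borel_rV R m)%type R)
    (F : borel_rV R m -> \bar R) :
  coupling Q Q' g -> measurable_fun setT F -> (forall x, 0 <= F x)%E ->
  (\int[Q]_x F x = \int[g]_z F z.1)%E /\ (\int[Q']_x F x = \int[g]_z F z.2)%E.
Proof.
move=> gQ mF F0; split.
- rewrite -(@eq_measure_integral _ _ _ setT Q (pushforward g fst) F).
    by rewrite ge0_integral_pushforward//; exact: measurable_fst.
  move=> A mA _; apply: etrans (gQ A mA).1; rewrite /pushforward; congr (g _).
  by apply/seteqP; split => z //= [].
- rewrite -(@eq_measure_integral _ _ _ setT Q' (pushforward g snd) F).
    by rewrite ge0_integral_pushforward//; exact: measurable_snd.
  move=> A mA _; apply: etrans (gQ A mA).2; rewrite /pushforward; congr (g _).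
  by apply/seteqP; split => z //= [].
Qed.

(** The easy half of Kantorovich duality: integrate [f z.1 <= f z.2 + L * eucl_dist z.1 z.2], and
    its mirror image, against the coupling. *)
Lemma lipschitz_integral_coupling (R : realType) (m : nat) (Xi : set 'rV[R]_m)
    (L c : R) (f : 'rV[R]_m -> R) (Q Q' : probability (borel_rV R m) R)
    (g : probability (borel_rV R m * borel_rV R m)%type R) :
  measurable (Xi : set (borel_rV R m)) ->
  measurable_fun (Xi : set (borel_rV R m)) f ->
  (forall x, Xi x -> 0 <= f x) -> eucl_lipschitz_on Xi L f ->
  Q Xi = 1%E -> Q' Xi = 1%E -> coupling Q Q' g ->
  (\int[g]_z (eucl_dist z.1 z.2)%:E <= c%:E)%E ->
  (\int[Q]_(x in Xi) (f x)%:E <= \int[Q']_(x in Xi) (f x)%:E + (L * c)%:E)%E /\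
  (\int[Q']_(x in Xi) (f x)%:E <= \int[Q]_(x in Xi) (f x)%:E + (L * c)%:E)%E.
Proof.
move=> mXi mf f0 [L0 fL] QXi Q'Xi gQ gc.
(* Extension by 0 turns integrals over [Xi] into integrals over the whole space. The extension need
   not be Lipschitz, so the pointwise bound is used only almost everywhere. *)
pose F := (fun x => (f x)%:E) \_ Xi.
have F0 x : (0 <= F x)%E.
  by rewrite /F patchE; case: ifPn => // /set_mem xXi; rewrite lee_fin f0.
have mF : measurable_fun [set: borel_rV R m] F.
  apply/(measurable_restrictT _ mXi).
  exact/measurable_EFinP.
have [QF Q'F] := coupling_integral gQ mF F0.
have gXi := coupling_ae mXi gQ QXi Q'Xi.
have mF1 : measurable_fun setT (fun z : borel_rV R m * borel_rV R m => F z.1).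
  exact: (measurableT_comp mF measurable_fst).
have mF2 : measurable_fun setT (fun z : borel_rV R m * borel_rV R m => F z.2).
  exact: (measurableT_comp mF measurable_snd).
have d0 (z : borel_rV R m * borel_rV R m) : (0 <= (eucl_dist z.1 z.2)%:E)%E.
  by rewrite lee_fin sqrtr_ge0.
have md : measurable_fun setT
    (fun z : borel_rV R m * borel_rV R m => (eucl_dist z.1 z.2)%:E).
  by apply/measurable_EFinP; exact: measurable_eucl_dist.
(* Stated for two arbitrary integrands so that exchanging the two projections yields both
   inequalities. *)
have key (a b : borel_rV R m * borel_rV R m -> \bar R) :
    measurable_fun setT a -> measurable_fun setT b ->
    (forall z, 0 <= a z)%E -> (forall z, 0 <= b z)%E ->
    (forall z, Xi z.1 -> Xi z.2 ->
       a z <= b z + L%:E * (eucl_dist z.1 z.2)%:E)%E ->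
    (\int[g]_z a z <= \int[g]_z b z + (L * c)%:E)%E.
  move=> ma mb a0 b0 ab.
  have mLd := measurable_funeM L%:E md.
  have Ld0 (z : borel_rV R m * borel_rV R m) :
      (0 <= L%:E * (eucl_dist z.1 z.2)%:E :> \bar R)%E.
    apply: mule_ge0; [by rewrite lee_fin|exact: d0].
  apply: (@le_trans _ _ (\int[g]_z (b z + L%:E * (eucl_dist z.1 z.2)%:E))%E).
    apply: ae_ge0_le_integral => //.
    - by move=> z _; rewrite adde_ge0.
    - exact: emeasurable_funD.
    - case: gXi => A [mA gA subA]; exists A; split => //.
      by apply: subset_trans subA; apply: subsetC => z [z1 z2] _; exact: ab.
  rewrite ge0_integralD// leeD2l// ge0_integralZl_EFin// EFinM.
  by rewrite lee_wpmul2l ?lee_fin.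
have Fin x : Xi x -> F x = (f x)%:E by move=> xXi; rewrite /F patchE mem_set.
have IF (P : probability (borel_rV R m) R) :
    (\int[P]_(x in Xi) (f x)%:E = \int[P]_x F x)%E by exact: integral_mkcond.
rewrite !IF QF Q'F; split; apply: key => // z z1 z2.
- rewrite !Fin// -EFinM -EFinD lee_fin -lerBlDl.
  exact: le_trans (ler_norm _) (fL _ _ z1 z2).
- rewrite !Fin// -EFinM -EFinD lee_fin -lerBlDl.
  by apply: le_trans (fL _ _ z1 z2); rewrite distrC ler_norm.
Qed.

(** * From coupling bounds to bounds in terms of [wasserstein] *)

Lemma eq_wasserstein (R : realType) (m : nat) (p : R)
    (Q M M' : set (borel_rV R m) -> \bar R) :
  (forall A, measurable A -> M A = M' A) ->
  wasserstein p Q M = wasserstein p Q M'.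
Proof.
move=> MM'; rewrite /wasserstein; congr (ereal_inf (_ @` _) `^ _)%E.
apply/seteqP; split => g gQ A mA; have [? ?] := gQ A mA.
  by rewrite -MM'.
by rewrite MM'.
Qed.

(* An empirical law is only a set function here; the second marginal of any
   coupling is a genuine probability agreeing with it on measurable sets. *)
Lemma wasserstein_probability (R : realType) (m : nat) (p c : R)
    (Q M : set (borel_rV R m) -> \bar R) :
  1 <= p -> (wasserstein p Q M <= c%:E)%E ->
  exists M' : probability (borel_rV R m) R,
    forall A, measurable A -> M A = M' A.
Proof.
move=> p1 Wc.
(* The slack 1 is arbitrary: only the existence of some coupling matters. *)
have /(wasserstein_coupling p1)[g gM _] : (wasserstein p Q M < (c + 1)%:E)%E.
  by apply: le_lt_trans Wc _; rewrite lte_fin ltrDl.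
pose pi2 : {mfun (borel_rV R m * borel_rV R m)%type >-> borel_rV R m} :=
  HB.pack (@snd (borel_rV R m) (borel_rV R m))
    (isMeasurableFun.Build _ _ _ _ _ measurable_snd).
exists (distribution g pi2) => A mA; have [_ <-] := gM A mA.
rewrite /distribution /pushforward; congr (g _).
by apply/seteqP; split => z //= [].
Qed.

Section integral_comparison.
Context (R : realType) (m : nat) (Xi : set 'rV[R]_m) (L p : R)
  (f : 'rV[R]_m -> R)
  (mXi : measurable (Xi : set (borel_rV R m)))
  (mf : measurable_fun (Xi : set (borel_rV R m)) f)
  (f0 : forall x, Xi x -> 0 <= f x)
  (fL : eucl_lipschitz_on Xi L f) (p1 : 1 <= p).

Let I (Q : probability (borel_rV R m) R) := (\int[Q]_(x in Xi) (f x)%:E)%E.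

Lemma lipschitz_integral_wasserstein (eps : R)
    (Q Q' : probability (borel_rV R m) R) :
  Q Xi = 1%E -> Q' Xi = 1%E -> (wasserstein p Q Q' <= eps%:E)%E ->
  (I Q <= I Q' + (L * eps)%:E)%E /\ (I Q' <= I Q + (L * eps)%:E)%E.
Proof.
move=> QXi Q'Xi Weps; have [L0 _] := fL.
have H (e : R) : 0 < e -> exists2 c, L * c <= L * eps + e &
    (I Q <= I Q' + (L * c)%:E)%E /\ (I Q' <= I Q + (L * c)%:E)%E.
  (* The excess [e / (L + 1)] costs at most [e] after multiplication by [L], and the denominator
     stays positive when [L = 0]. *)
  move=> e0; have L1 : 0 < L + 1 by rewrite ltr_wpDl.
  have [|g gQ gc] := @wasserstein_coupling _ _ p (eps + e / (L + 1)) Q Q' p1.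
    by apply: le_lt_trans Weps _; rewrite lte_fin ltrDl divr_gt0.
  exists (eps + e / (L + 1)); last exact: lipschitz_integral_coupling gc.
  rewrite mulrDr lerD2l mulrCA ler_piMr ?(ltW e0)//.
  by rewrite ler_pdivrMr// mul1r lerDl.
split; apply/lee_addgt0Pr => e /H[c ce [H1 H2]]; rewrite -addeA -EFinD.
  by apply: le_trans H1 _; rewrite leeD2l// lee_fin.
by apply: le_trans H2 _; rewrite leeD2l// lee_fin.
Qed.

(** Two comparisons, [Q] with the common centre and the centre with [P], cost [L * eps] each. *)
Lemma lipschitz_integral_ball (eps : R)
    (Q P : probability (borel_rV R m) R) (M : set (borel_rV R m) -> \bar R) :
  Q Xi = 1%E -> P Xi = 1%E -> M Xi = 1%E ->
  (wasserstein p Q M <= eps%:E)%E -> (wasserstein p P M <= eps%:E)%E ->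
  (I Q <= I P + (L * (2 * eps))%:E)%E.
Proof.
move=> QXi PXi MXi WQ WP; have [M' MM'] := wasserstein_probability p1 WQ.
have M'Xi : M' Xi = 1%E by rewrite -MM'.
move: WQ WP; rewrite !(eq_wasserstein p _ MM') => WQ WP.
have [H1 _] := lipschitz_integral_wasserstein QXi M'Xi WQ.
have [_ H2] := lipschitz_integral_wasserstein PXi M'Xi WP.
apply: le_trans H1 _; apply: le_trans (leeD2r _ H2) _.
by rewrite -addeA -EFinD -mulrDr -mulr2n mulr_natl.
Qed.

End integral_comparison.

(** * Integrals against mixtures, and the deterministic bound over the global ball *)

Lemma integral_mixture (R : realType) (m n : nat) (Xi : set 'rV[R]_m)
    (f : 'rV[R]_m -> R) (a : 'I_n -> R)
    (Q : 'I_n -> probability (borel_rV R m) R)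
    (S : probability (borel_rV R m) R) :
  measurable (Xi : set (borel_rV R m)) ->
  measurable_fun (Xi : set (borel_rV R m)) f ->
  (forall x, Xi x -> 0 <= f x) -> (forall i, 0 <= a i) -> is_mixture a Q S ->
  (\int[S]_(x in Xi) (f x)%:E =
   \sum_(i < n) (a i)%:E * \int[Q i]_(x in Xi) (f x)%:E)%E.
Proof.
move=> mXi mf f0 a0 SQ.
have mF : measurable_fun (Xi : set (borel_rV R m)) (fun x => (f x)%:E).
  exact/measurable_EFinP.
have F0 x : Xi x -> (0 <= (f x)%:E)%E by move=> xXi; rewrite lee_fin f0.
(* [msum] sums a sequence of measures indexed by [nat]; the zero measure fills the indices from [n]
   on. *)
pose M (k : nat) : {measure set (borel_rV R m) -> \bar R} :=
  if insub k is Some i then mscale (NngNum (a0 i)) (Q i) else mzero.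
transitivity (\int[msum M n]_(x in Xi) (f x)%:E)%E.
  apply: eq_measure_integral => A mA _; apply: etrans (SQ A mA) _.
  rewrite /msum/=.
  by apply: eq_bigr => i _; rewrite /M valK.
rewrite ge0_integral_measure_sum//; apply: eq_bigr => i _.
by rewrite /M valK ge0_integral_mscale.
Qed.

(** A product neighbourhood of [(x, y)] has [x] in its first factor, so its slice at [x] contains a
    neighbourhood of [y]. *)
Lemma within_continuous_section (T U V : topologicalType) (A : set T)
    (B : set U) (f : T * U -> V) (x : T) :
  {within A `*` B, continuous f} -> A x ->
  {within B, continuous (fun y => f (x, y))}.
Proof.
move=> /subspace_continuousP cf Ax; apply/subspace_continuousP => y By.
apply: cvg_trans (cf (x, y) (conj Ax By)).
move=> W /= [[W1 W2] /= [nW1 nW2] W12].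
apply: filterS nW2 => z W2z Bz.
by apply: (W12 (x, z)) => //; split => //=; exact: nbhs_singleton.
Qed.

(** The gap is uniform over all pairs [i], [j], so it survives averaging over [i] with weights [a]
    and then over [j] with the unrelated weights [b]. *)
Lemma integral_mixture_gap (R : realType) (m n : nat) (Xi : set 'rV[R]_m)
    (f : 'rV[R]_m -> R) (a b : 'I_n -> R) (c : R)
    (Q P : 'I_n -> probability (borel_rV R m) R)
    (S T : probability (borel_rV R m) R) :
  measurable (Xi : set (borel_rV R m)) ->
  measurable_fun (Xi : set (borel_rV R m)) f ->
  (forall x, Xi x -> 0 <= f x) ->
  simplex a -> simplex b -> is_mixture a Q S -> is_mixture b P T ->
  (forall i j, (\int[Q i]_(x in Xi) (f x)%:E <=
                \int[P j]_(x in Xi) (f x)%:E + c%:E)%E) ->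
  (\int[S]_(x in Xi) (f x)%:E <= \int[T]_(x in Xi) (f x)%:E + c%:E)%E.
Proof.
move=> mXi mf f0 [a0 a1] [b0 b1] SQ TP QP.
have simplexE (w : 'I_n -> R) (y : \bar R) :
    (forall i, 0 <= w i) -> \sum_(i < n) w i = 1 ->
    (\sum_(i < n) (w i)%:E * y = y)%E.
  move=> w0 w1; rewrite -ge0_sume_distrl ?sumEFin ?w1 ?mul1e// => i _.
  by rewrite lee_fin.
have SP j :
    (\int[S]_(x in Xi) (f x)%:E <= \int[P j]_(x in Xi) (f x)%:E + c%:E)%E.
  rewrite (integral_mixture mXi mf f0 a0 SQ) -[leRHS](simplexE _ _ a0 a1).
  by apply: lee_sum => i _; apply: lee_wpmul2l; rewrite ?lee_fin.
(* With [c] moved to the left, that side does not depend on [j] and is its own average under [b]. *)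
rewrite -leeBlDr// (integral_mixture mXi mf f0 b0 TP).
rewrite -[leLHS](simplexE _ _ b0 b1).
apply: lee_sum => j _; apply: lee_wpmul2l; first by rewrite lee_fin.
by rewrite leeBlDr.
Qed.

(** Serves to undo the shift that makes a bounded cost nonnegative: against a probability carried by
    [Xi], the constant [M] integrates to itself. *)
Lemma bounded_integral_fin_num (R : realType) (m : nat) (Xi : set 'rV[R]_m)
    (f : 'rV[R]_m -> R) (M : R) (Q : probability (borel_rV R m) R) :
  measurable (Xi : set (borel_rV R m)) ->
  measurable_fun (Xi : set (borel_rV R m)) f ->
  (forall x, Xi x -> `|f x| <= M) -> Q Xi = 1%E ->
  (\int[Q]_(x in Xi) (f x)%:E)%E \is a fin_num /\
  (\int[Q]_(x in Xi) (f x + M)%:E = \int[Q]_(x in Xi) (f x)%:E + M%:E)%E.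
Proof.
move=> mXi mf fM QXi.
have iM (g : borel_rV R m -> R) (K : R) :
    measurable_fun (Xi : set (borel_rV R m)) g ->
    (forall x, Xi x -> `|g x| <= K) -> Q.-integrable Xi (EFin \o g).
  move=> mg gK; apply: measurable_bounded_integrable => //.
    by apply: etrans (congr1 (fun t => t < +oo)%E QXi) _; exact: ltry.
  exists K; split; first exact: num_real.
  by move=> K' KK' x /gK /le_trans; apply; exact: ltW.
have intf := iM f M mf fM; split; first exact: integrable_fin_num.
have intM : Q.-integrable Xi (EFin \o cst M) by apply: (iM _ `|M|) => //.
transitivity (\int[Q]_(x in Xi) ((f x)%:E + (cst M x)%:E))%E => //.
rewrite integralD//; congr (_ + _)%E.
rewrite (_ : (\int[Q]_(x in Xi) (cst M x)%:E = M%:E * Q Xi)%E); last first.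
  exact: (integral_cst _ mXi M%:E).
by apply: etrans (congr1 (fun t => M%:E * t)%E QXi) _; rewrite mule1.
Qed.

(** In the constant, [2 * r] pays for passing from [Q i] to [P i] through the empirical law, and
    [delta] for passing from [P i] to [P j]. The weights of [S] may differ from the true weights
    [b], hence the comparison for all pairs. *)
Lemma global_ball_gap (R : realType) (m n : nat) (Xi : set 'rV[R]_m)
    (p L delta r : R) (f : 'rV[R]_m -> R) (N : 'I_n -> nat)
    (x : forall i, 'I_(N i) -> 'rV[R]_m) (eps b : 'I_n -> R)
    (P : 'I_n -> probability (borel_rV R m) R)
    (S T : probability (borel_rV R m) R) :
  compact Xi -> {within Xi, continuous f} -> eucl_lipschitz_on Xi L f ->
  1 <= p -> (forall i, 0 < N i)%N -> (forall i k, Xi (x i k)) ->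
  (forall i, eps i <= r) ->
  (forall i, local_ball p Xi (x i) (eps i) (P i)) ->
  (forall i j, (wasserstein p (P i) (P j) <= delta%:E)%E) ->
  simplex b -> is_mixture b P T -> T Xi = 1%E ->
  global_ball p Xi x eps S -> S Xi = 1%E ->
  (\int[S]_(y in Xi) (f y)%:E <=
   \int[T]_(y in Xi) (f y)%:E + (L * (2 * r + delta))%:E)%E.
Proof.
move=> cXi cf fL p1 N0 xXi epsr PB PP bS TP TXi [a [Q [aS QB SQ]]] SXi.
have [L0 _] := fL.
have mXi : measurable (Xi : set (borel_rV R m)) by exact: compact_measurable_rV.
have mf := within_continuous_measurable_rV mXi cf.
have [M fM] : exists M : R, forall y, Xi y -> `|f y| <= M.
  have [M0 [_ M0f]] := compact_bounded (continuous_compact cf cXi).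
  exists (M0 + 1) => y Xiy; apply: (M0f (M0 + 1)); first by rewrite ltrDl.
  by exists y.
(* Shifting by a bound of |f| leaves only integrals of nonnegative functions. *)
pose F y := f y + M.
have F0 y : Xi y -> 0 <= F y.
  by move=> /fM; rewrite ler_norml => /andP[+ _]; rewrite -subr_ge0 opprK.
have mF : measurable_fun (Xi : set (borel_rV R m)) F.
  by apply: measurable_funD => //; exact: measurable_cst.
have FL : eucl_lipschitz_on Xi L F.
  split => // y z yXi zXi; rewrite /F opprD addrACA subrr addr0.
  by have [_] := fL; exact.
have xi1 i : empirical (x i) Xi = 1%E.
  rewrite /empirical (eq_bigr (fun=> 1%E)); last first.
    by move=> k _; rewrite diracE mem_set.
  by rewrite sumEFin sumr_const card_ord -EFinM mulVf// pnatr_eq0 -lt0n.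
pose I h (U : probability (borel_rV R m) R) := (\int[U]_(y in Xi) (h y)%:E)%E.
have IF (U : probability (borel_rV R m) R) : U Xi = 1%E ->
    I f U \is a fin_num /\ (I F U = I f U + M%:E)%E.
  exact: bounded_integral_fin_num.
have [fS FS] := IF S SXi; have [fT FT] := IF T TXi.
change (I f S <= I f T + (L * (2 * r + delta))%:E)%E.
(* The shift adds the same finite [M] to both sides and cancels. *)
suff : (I F S <= I F T + (L * (2 * r + delta))%:E)%E.
  by rewrite FS FT addeAC leeD2rE.
apply: integral_mixture_gap SQ TP _ => // i j.
have [[QXi _] WQ] := QB i; have [[PXi _] WP] := PB i.
have [[PjXi _] _] := PB j.
have H1 := lipschitz_integral_ball mXi mF F0 FL p1 QXi PXi (xi1 i) WQ WP.
have [H2 _] := lipschitz_integral_wasserstein mXi mF F0 FL p1 PXi PjXi (PP i j).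
apply: le_trans H1 _; apply: le_trans (leeD2r _ H2) _.
rewrite -addeA leeD2l// -EFinD lee_fin -mulrDr ler_wpM2l//.
by rewrite addrC lerD2r ler_pM2l.
Qed.

Lemma mixture_full (R : realType) (m n : nat) (Xi : set 'rV[R]_m)
    (a : 'I_n -> R) (Q : 'I_n -> probability (borel_rV R m) R)
    (S : probability (borel_rV R m) R) :
  measurable (Xi : set (borel_rV R m)) -> simplex a -> is_mixture a Q S ->
  (forall i, Q i Xi = 1%E) -> S Xi = 1%E.
Proof.
move=> mXi [_ a1] SQ QXi; rewrite (SQ _ mXi).
under eq_bigr do rewrite QXi mule1.
by rewrite sumEFin a1.
Qed.

(** * Sample events and independence *)

Lemma sigma_of_sample_measurable (R : realType) (d : measure_display)
    (Omega : measurableType d) (Pr : probability Omega R) (m N : nat)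
    (X : 'I_N -> {RV Pr >-> borel_rV R m}) :
  sigma_of_sample X `<=` measurable.
Proof.
apply: smallest_sub; first exact: sigma_algebra_measurable.
by move=> _ [k _ [B mB <-]]; exact: measurable_funP.
Qed.

(** Independence within one sample makes the probability a product of factors [Q Xi = 1]. Membership
    in the sample's own sigma-algebra is recorded for the later use of independence between
    clients. *)
Lemma sample_in_support (R : realType) (d : measure_display)
    (Omega : measurableType d) (Pr : probability Omega R) (m N : nat)
    (Q : probability (borel_rV R m) R) (X : 'I_N -> {RV Pr >-> borel_rV R m})
    (Xi : set (borel_rV R m)) :
  measurable Xi -> Q Xi = 1%E -> iid_sample Q X ->
  sigma_of_sample X [set w | forall k, Xi (X k w)] /\
  Pr [set w | forall k, Xi (X k w)] = 1%E.
Proof.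
move=> mXi QXi [XQ Xind].
have GE : [set w | forall k, Xi (X k w)] =
    \bigcap_(k in [set` [set: 'I_N]%SET]) (X k @^-1` Xi).
  apply/seteqP; split => w /= H k; first by move=> _; exact: H.
  by apply: H; rewrite /= inE.
have sX k : sigma_of (X k) (X k @^-1` Xi) by exists Xi => //; rewrite setTI.
rewrite GE; split.
  apply: (@fin_bigcap_measurable _
    (g_sigma_algebraType (\bigcup_k sigma_of (X k)))) => [|k _].
    exact: finite_finset.
  by apply: sub_sigma_algebra; exists k.
rewrite Xind//; apply: big1 => k _; rewrite -QXi; exact: XQ.
Qed.

(** The product rule is applied to the witnesses [E i], which lie in the independent classes; the
    sets [A i] themselves may fail to be measurable. *)
Lemma independent_prob_at_least (R : realType) (d : measure_display)
    (Omega : measurableType d) (Pr : probability Omega R) (n : nat)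
    (F : 'I_n -> set (set Omega)) (A : 'I_n -> set Omega) (q : 'I_n -> R) :
  independent_classes Pr F -> (forall i, F i `<=` measurable) ->
  (forall i, 0 <= q i) -> (forall i, prob_at_least Pr (F i) (A i) (q i)) ->
  prob_at_least Pr measurable (\bigcap_i A i) (\prod_(i < n) q i).
Proof.
move=> Find Fm q0 /(_ _)/cid-/all_sig[E /all_and3[FE EA qE]].
exists (\bigcap_(i in [set` [set: 'I_n]%SET]) E i); split.
- apply: fin_bigcap_measurable; first exact: finite_finset.
  by move=> i _; exact: Fm.
- by move=> w Ew i _; apply/EA/Ew; rewrite /= inE.
- rewrite Find// [leRHS](eq_bigl xpredT); last by move=> i; rewrite inE.
  (* Nonnegativity of the partial products is carried through the induction because multiplying
     inequalities needs it. *)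
  have [] // : 0 <= \prod_(i < n) q i /\
      ((\prod_(i < n) q i)%:E <= \prod_(i < n) Pr (E i))%E.
  elim/big_rec2: _ => [|i y x _ [x0 xy]]; first by rewrite ler01 lexx.
  by rewrite mulr_ge0// EFinM; split => //; apply: lee_pmul; rewrite ?lee_fin.
Qed.

Lemma prob_at_leastI_full (R : realType) (d : measure_display)
    (Omega : measurableType d) (Pr : probability Omega R)
    (F : set (set Omega)) (A B : set Omega) (q : R) :
  setI_closed F -> F `<=` measurable -> F B -> Pr B = 1%E ->
  prob_at_least Pr F A q -> prob_at_least Pr F (A `&` B) q.
Proof.
move=> FI Fm FB PB [E [FE EA qE]]; exists (E `&` B); split.
- exact: FI.
- exact: setSI.
- by rewrite probability_setI_full//; exact: Fm.
Qed.

(** * Combination of the probability estimate with the two deterministic bounds *)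

Theorem theorem5 (R : realType) (n m d : nat)
  (Xi : set 'rV[R]_m) (X : set 'rV[R]_d)
  (Xi_convex : convex_set Xi) (Xi_compact : compact Xi)
  (X_convex : convex_set X) (X_compact : compact X)
  (p : R) (p_ge1 : 1 <= p)
  (ell : 'rV[R]_d -> 'rV[R]_m -> R)
  (ell_continuous : {within X `*` Xi,
     continuous (fun z : 'rV[R]_d * 'rV[R]_m => ell z.1 z.2)})
  (L : R)
  (ell_lipschitz : forall x, X x -> eucl_lipschitz_on Xi L (ell x))
  (P : 'I_n -> probability (borel_rV R m) R)
  (P_on : forall i, prob_on p Xi (P i))
  (alpha : 'I_n -> R) (alpha_simplex : simplex alpha)
  (Ptrue : probability (borel_rV R m) R)
  (Ptrue_mixture : is_mixture alpha P Ptrue)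
  (delta : R) (delta_ge0 : 0 <= delta)
  (P_close : forall i j, (wasserstein p (P i) (P j) <= delta%:E)%E)
  (c1 c2 : R) (radius_ok : radius_well_defined c1 c2)
  (P_concentration : forall i, concentration p Xi c1 c2 (P i))
  (N : 'I_n -> nat) (N_ge1 : forall i, (1 <= N i)%N)
  (beta : 'I_n -> R) (beta_itv : forall i, 0 < beta i < 1)
  (dO : measure_display) (Omega : measurableType dO)
  (Pr : probability Omega R)
  (xi : forall i : 'I_n, 'I_(N i) -> {RV Pr >-> borel_rV R m})
  (xi_iid : forall i, iid_sample (P i) (xi i))
  (datasets_independent :
     independent_classes Pr (fun i => sigma_of_sample (xi i)))
  (xhat : Omega -> 'rV[R]_d) :
  let eps := fun i => conc_radius p Xi c1 c2 (N i) (beta i) in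
  let WG := fun w => global_ball p Xi (fun i k => xi i k w) eps in
  (forall w, is_optimizer X Xi ell (WG w) (xhat w)) ->
  let Jhat := fun w => optimal_value X Xi ell (WG w) in
  let J := fun w => expected_cost Xi ell Ptrue (xhat w) in
  let r := \big[Num.max/0]_(i < n) eps i in
  prob_at_least Pr measurable
    [set w | (Jhat w - (L * (2 * r + delta))%:E <= J w)%E /\
             (J w <= Jhat w)%E]
    (\prod_(i < n) (1 - beta i)).
Proof.
move=> eps WG opt Jhat J r.
have mXi : measurable (Xi : set (borel_rV R m)) by exact: compact_measurable_rV.
have PXi i : P i Xi = 1%E by have [] := P_on i.
have PtXi : Ptrue Xi = 1%E := mixture_full mXi alpha_simplex Ptrue_mixture PXi.
(* The support condition is included because the comparison through the empirical law requires that
   law to be carried by [Xi]. *)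
pose good i := [set w | (wasserstein p (P i) (empirical (fun k => xi i k w))
  <= (eps i)%:E)%E] `&` [set w | forall k, Xi (xi i k w)].
have goodP i : prob_at_least Pr (sigma_of_sample (xi i)) (good i) (1 - beta i).
  have [sG PG] := sample_in_support mXi (PXi i) (xi_iid i).
  apply: prob_at_leastI_full PG _ => //.
  - by move=> A B mA mB; exact: (@measurableI _
      (g_sigma_algebraType (\bigcup_k sigma_of (xi i k)))).
  - exact: sigma_of_sample_measurable.
  - exact: P_concentration.
have beta0 i : 0 <= 1 - beta i.
  by have /andP[_ /ltW] := beta_itv i; rewrite subr_ge0.
have [E [mE EG qE]] := independent_prob_at_least datasets_independent
  (fun i => @sigma_of_sample_measurable _ _ _ _ _ _ (xi i)) beta0 goodP.
exists E; split => // w /EG gw.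
have PB i : local_ball p Xi (fun k => xi i k w) (eps i) (P i).
  by have [] := gw i I.
have xXi i k : Xi (xi i k w) by have [] := gw i I.
have [Xx opt_val] := opt w.
(* Optimality replaces the infimum over decisions by the supremum at [xhat w], so both bounds
   concern a single decision. *)
have JhatE : Jhat w = worst_case_cost Xi ell (WG w) (xhat w) by [].
split; rewrite JhatE.
(* The lower bound on [J w] follows once every [S] in the global ball costs at most [J w] plus the
   gap. *)
- rewrite leeBlDr//; apply: ge_ereal_sup => _ [S WS <-].
  have SXi : S Xi = 1%E.
    have [a [Q [aS QB SQ]]] := WS.
    by apply: mixture_full SQ _ => // i; have [[]] := QB i.
  apply: global_ball_gap alpha_simplex Ptrue_mixture PtXi WS SXi => //.
  + exact: within_continuous_section ell_continuous Xx.
  + exact: ell_lipschitz.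
  + by move=> i; rewrite /r (bigmax_sup i).
(* On this event the true weights and client laws themselves witness that [Ptrue] lies in the global
   ball. *)
- by apply: ereal_sup_ubound; exists Ptrue => //; exists alpha, P.
Qed.
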